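(* Given a point $(\hat x,\hat y,\hat u)\in\mathbb{R}_+^{3T-1}$, there exists an $\mathcal{O}(T^3)$ time separation algorithm that finds the most violated inequality at $(\hat x,\hat y,\hat u)$, if any is violated, among the family of inequalities \begin{align*} x_t\le{}&\overline{V}y_t+V\sum_{i\in S}(i-d_i)\Bigl(y_i-\sum_{j=0}^{L-1}u_{i-j}\Bigr)+V\sum_{k=1}^{[n-1]^+}\Bigl(y_{t+k}-\sum_{j=0}^{L-1}u_{t+k-j}\Bigr)\\ &+\alpha(S,t)\,V\Bigl(y_{t+n}-\sum_{j=0}^{L-1}u_{t+n-j}\Bigr)+\beta(t)\Bigl(y_{t-m}-\sum_{j=0}^{L-1}u_{t-m-j}\Bigr)+\phi(u,t) \end{align*} indexed by all admissible $(t,m,n,S)$. Here $(t,m,n,S)$ is admissible if $t\in[L+1,T]_{\mathbb{Z}}$; $m$ is an integer with $0\le m\le\min\{t-L-1,[(\overline{C}-\overline{V})/V-L+1]^+\}$; $n\in[\min\{1,T-t\},\min\{L-1,T-t\}]_{\mathbb{Z}}$ if $L\ge2$ and $n=0$ if $L=1$; $n\ge(L-1)/2$ if $n\le T-t-1$; and $S\subseteq[t-m+1,t]_{\mathbb{Z}}$. Moreover $d_i=\max\{a\in S\cup\{t-m\}:a<i\}$ for $i\in S$, $\alpha(S,t)=m+L-1-\sum_{i\in S}(i-d_i)-[n-1]^+$, $\beta(t)=\overline{C}-\overline{V}-(m+L-1)V$, and $\phi(u,t)=V\sum_{k=1}^{t+L-T-1}k\,u_{t-k}+V\sum_{k=[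t+L-T]^+}^{L-1}\min\{L-1-k,k\}\,u_{t-k}$.
   Context: $T$ (number of time periods) and $L$ (minimum-up time) are positive integers with $T\ge L+1$, and $\overline{C},\overline{V},V$ are real parameters (generation upper bound, start-up/shut-down ramp rate, ramp rate) with $\overline{V}\le\overline{C}$ and $V>0$. Vectors are $x=(x_1,\dots,x_T)$, $y=(y_1,\dots,y_T)$, $u=(u_2,\dots,u_T)$, so $(x,y,u)\in\mathbb{R}^{3T-1}$. For integers $a,b$, $[a,b]_{\mathbb{Z}}$ is the set of integers $i$ with $a\le i\le b$; $[a]^+=\max\{a,0\}$; empty sums are $0$. The violation of an inequality at a point is its left-hand side minus its right-hand side evaluated at the point; an inequality is violated if this is positive, and most violated means maximum violation over the family. In the running time bound, the numbers $[(\overline{C}-\overline{V})/V-L+1]^+$ and $L-1$ (bounding $m$ and $n$) are regarded as constants, and the asymptotics are in $T$. *)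

(* Defs.v *)
From HB Require Import structures.
From mathcomp Require Import all_boot all_order all_algebra.
From mathcomp Require Import reals.

Set Implicit Arguments.
Unset Strict Implicit.
Unset Printing Implicit Defensive.

Import Order.TTheory GRing.Theory Num.Theory.
Local Open Scope ring_scope.

(* A real RAM, in structured form: one finite program handles all input sizes
   and all real data. Memory consists of scalar variables and (unbounded,
   indirectly addressed) arrays, holding either natural numbers or exact reals;
   variables and arrays are named by natural numbers fixed in the program text.
   Naturals support +, truncated - and comparison only; reals support the field
   operations and comparison. The only real literals are natural numbers, and
   there is no rounding or any other conversion between the two sorts. *)
Inductive nexp :=
  | NConst of nat
  | NVar of nat
  | NGet of nat & nexp
  | NAdd of nexp & nexp
  | NSub of nexp & nexp.

Inductive rexp :=
  | RConst of nat
  | RVar of nat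
  | RGet of nat & nexp
  | RAdd of rexp & rexp
  | RSub of rexp & rexp
  | RMul of rexp & rexp
  | RDiv of rexp & rexp.

Inductive bexp :=
  | BNle of nexp & nexp
  | BRle of rexp & rexp
  | BNot of bexp
  | BAnd of bexp & bexp.

Inductive cmd :=
  | Skip
  | NAssign of nat & nexp
  | NSet of nat & nexp & nexp
  | RAssign of nat & rexp
  | RSet of nat & nexp & rexp
  | Seq of cmd & cmd
  | If of bexp & cmd & cmd
  | While of bexp & cmd.

Record state (R : realType) := State {
  nvar : nat -> nat;
  narr : nat -> nat -> nat;
  rvar : nat -> R;
  rarr : nat -> nat -> R }.

Definition upd (A : Type) (f : nat -> A) (i : nat) (v : A) : nat -> A :=
  fun j => if j == i then v else f j.

Definition upd2 (A : Type) (f : nat -> nat -> A) (a i : nat) (v : A) :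
  nat -> nat -> A := upd f a (upd (f a) i v).

Section Semantics.
Context {R : realType}.
Implicit Types (s : state R) (e : nexp) (r : rexp) (b : bexp).

Fixpoint neval s e : nat :=
  match e with
  | NConst c => c
  | NVar v => nvar s v
  | NGet a i => narr s a (neval s i)
  | NAdd e1 e2 => (neval s e1 + neval s e2)%N
  | NSub e1 e2 => (neval s e1 - neval s e2)%N
  end.

(* Division by zero yields zero, as in [R]. *)
Fixpoint reval s r : R :=
  match r with
  | RConst c => c%:R
  | RVar v => rvar s v
  | RGet a i => rarr s a (neval s i)
  | RAdd r1 r2 => reval s r1 + reval s r2
  | RSub r1 r2 => reval s r1 - reval s r2
  | RMul r1 r2 => reval s r1 * reval s r2
  | RDiv r1 r2 => reval s r1 / reval s r2
  end.

Fixpoint beval s b : bool :=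
  match b with
  | BNle e1 e2 => (neval s e1 <= neval s e2)%N
  | BRle r1 r2 => reval s r1 <= reval s r2
  | BNot b1 => ~~ beval s b1
  | BAnd b1 b2 => beval s b1 && beval s b2
  end.

End Semantics.

(* Unit cost: every literal, memory access, arithmetic operation, comparison,
   connective and assignment costs one step. *)
Fixpoint ncost (e : nexp) : nat :=
  match e with
  | NConst _ | NVar _ => 1
  | NGet _ i => (ncost i).+1
  | NAdd e1 e2 | NSub e1 e2 => (ncost e1 + ncost e2).+1
  end.

Fixpoint rcost (r : rexp) : nat :=
  match r with
  | RConst _ | RVar _ => 1
  | RGet _ i => (ncost i).+1
  | RAdd r1 r2 | RSub r1 r2 | RMul r1 r2 | RDiv r1 r2 =>
      (rcost r1 + rcost r2).+1
  end.

Fixpoint bcost (b : bexp) : nat :=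
  match b with
  | BNle e1 e2 => (ncost e1 + ncost e2).+1
  | BRle r1 r2 => (rcost r1 + rcost r2).+1
  | BNot b1 => (bcost b1).+1
  | BAnd b1 b2 => (bcost b1 + bcost b2).+1
  end.

Definition set_nvar (R : realType) (s : state R) v k :=
  State (upd (nvar s) v k) (narr s) (rvar s) (rarr s).
Definition set_narr (R : realType) (s : state R) a i k :=
  State (nvar s) (upd2 (narr s) a i k) (rvar s) (rarr s).
Definition set_rvar (R : realType) (s : state R) v z :=
  State (nvar s) (narr s) (upd (rvar s) v z) (rarr s).
Definition set_rarr (R : realType) (s : state R) a i z :=
  State (nvar s) (narr s) (rvar s) (upd2 (rarr s) a i z).

(* [exec c s s' k]: started in [s], [c] halts in [s'] after [k] steps. *)
Inductive exec (R : realType) : cmd -> state R -> state R -> nat -> Prop :=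
  | ExecSkip s : exec Skip s s 1
  | ExecNAssign s v e :
      exec (NAssign v e) s (set_nvar s v (neval s e)) (ncost e).+1
  | ExecNSet s a i e :
      exec (NSet a i e) s (set_narr s a (neval s i) (neval s e))
        (ncost i + ncost e).+1
  | ExecRAssign s v r :
      exec (RAssign v r) s (set_rvar s v (reval s r)) (rcost r).+1
  | ExecRSet s a i r :
      exec (RSet a i r) s (set_rarr s a (neval s i) (reval s r))
        (ncost i + rcost r).+1
  | ExecSeq s1 s2 s3 c1 c2 k1 k2 :
      exec c1 s1 s2 k1 -> exec c2 s2 s3 k2 ->
      exec (Seq c1 c2) s1 s3 (k1 + k2)
  | ExecIfTrue s s' b c1 c2 k :
      beval s b -> exec c1 s s' k -> exec (If b c1 c2) s s' (bcost b + k)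
  | ExecIfFalse s s' b c1 c2 k :
      ~~ beval s b -> exec c2 s s' k -> exec (If b c1 c2) s s' (bcost b + k)
  | ExecWhileTrue s1 s2 s3 b c k1 k2 :
      beval s1 b -> exec c s1 s2 k1 -> exec (While b c) s2 s3 k2 ->
      exec (While b c) s1 s3 (bcost b + k1 + k2)
  | ExecWhileFalse s b c :
      ~~ beval s b -> exec (While b c) s s (bcost b).

(* [horizon] is T, [uptime] is L, [cap] is C-bar, [startup] is V-bar, and
   [ramp] is V. *)
Record params (R : realType) := Params {
  horizon : nat;
  uptime : nat;
  cap : R;
  startup : R;
  ramp : R }.

Definition valid_params (R : realType) (p : params R) : Prop :=
  [/\ (0 < uptime p)%N, (uptime p + 1 <= horizon p)%N,
      startup p <= cap p & 0 < ramp p].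

(* [((C-bar) - (V-bar)) / V - L + 1]^+, the real upper bound on m. *)
Definition mbound (R : realType) (p : params R) : R :=
  Num.max ((cap p - startup p) / ramp p - (uptime p)%:R + 1) 0.

Record point (R : realType) (T : nat) := Point {
  xvec : 'rV[R]_T;
  yvec : 'rV[R]_T;
  uvec : 'rV[R]_(T - 1) }.

Definition nonneg_point (R : realType) (T : nat) (z : point R T) : Prop :=
  [/\ forall k, 0 <= xvec z 0 k, forall k, 0 <= yvec z 0 k &
      forall k, 0 <= uvec z 0 k].

(* Entry labelled [i] of a vector whose labels start at [b]; junk value 0. *)
Definition entry (R : realType) (n b : nat) (v : 'rV[R]_n) (i : nat) : R :=
  if (b <= i)%N then oapp (v 0) 0 (insub (i - b)%N) else 0.

Definition xc (R : realType) (T : nat) (z : point R T) := entry 1 (xvec z).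
Definition yc (R : realType) (T : nat) (z : point R T) := entry 1 (yvec z).
Definition uc (R : realType) (T : nat) (z : point R T) := entry 2 (uvec z).

(* The indices (t, m, n, S) of the family, S being a set of labels in {0..T}. *)
Record ineq_index (T : nat) := Index {
  it : nat;
  im : nat;
  inn : nat;
  iS : {set 'I_T.+1} }.

(* In the last-but-one clause, n + 1 <= T - t encodes n <= T - t - 1 without
   truncation at t = T, and L - 1 <= 2 n is n >= (L - 1) / 2. *)
Definition admissible (R : realType) (p : params R)
    (q : ineq_index (horizon p)) : Prop :=
  let T := horizon p in let L := uptime p in
  let: Index t m n A := q in
  [/\ (L + 1 <= t <= T)%N,
      (m <= t - L - 1)%N /\ m%:R <= mbound p,
      (if (2 <= L)%N
       then (minn 1 (T - t) <= n <= minn (L - 1) (T - t))%N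
       else n == 0%N),
      ((n + 1 <= T - t)%N -> (L - 1 <= 2 * n)%N) &
      forall i : 'I_T.+1, i \in A -> (t - m + 1 <= i <= t)%N].

(* max {a in S or a = t - m : a < i} *)
Definition pred_in (T : nat) (S : {set 'I_T.+1}) (t m i : nat) : nat :=
  \max_(a < T.+1 | ((a \in S) || (a == (t - m)%N :> nat)) && (a < i)%N) a.

(* y_i - sum_{j=0}^{L-1} u_{i-j} *)
Definition slack (R : realType) (p : params R) (z : point R (horizon p))
    (i : nat) : R :=
  yc z i - \sum_(0 <= j < uptime p) uc z (i - j)%N.

Definition alpha (R : realType) (p : params R) (q : ineq_index (horizon p)) : R :=
  let: Index t m n A := q in
  m%:R + (uptime p)%:R - 1
    - \sum_(i in A) (i%:R - (pred_in A t m i)%:R) - (n - 1)%:R.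

Definition beta (R : realType) (p : params R) (m : nat) : R :=
  cap p - startup p - (m%:R + (uptime p)%:R - 1) * ramp p.

(* The truncated t + L - T is [t + L - T]^+; it also makes the first sum run
   over 1 <= k <= t + L - T - 1, empty when t + L - T <= 1. *)
Definition phi (R : realType) (p : params R) (z : point R (horizon p))
    (t : nat) : R :=
  let T := horizon p in let L := uptime p in
  ramp p * (\sum_(1 <= k < t + L - T) k%:R * uc z (t - k)%N)
  + ramp p * (\sum_(t + L - T <= k < L)
                (minn (L - 1 - k) k)%:R * uc z (t - k)%N).

Definition rhs (R : realType) (p : params R) (z : point R (horizon p))
    (q : ineq_index (horizon p)) : R :=
  let: Index t m n A := q in
  startup p * yc z t
  + ramp p * (\sum_(i in A) (i%:R - (pred_in A t m i)%:R) * slack z i)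
  + ramp p * (\sum_(1 <= k < (n - 1).+1) slack z (t + k)%N)
  + alpha q * ramp p * slack z (t + n)%N
  + beta p m * slack z (t - m)%N
  + phi z t.

Definition violation (R : realType) (p : params R) (z : point R (horizon p))
    (q : ineq_index (horizon p)) : R := xc z (it q) - rhs z q.

Definition most_violated (R : realType) (p : params R)
    (z : point R (horizon p)) (q : ineq_index (horizon p)) : Prop :=
  [/\ admissible q, 0 < violation z q &
      forall q', admissible q' -> violation z q' <= violation z q].

(* Input convention. T and L are in natural variables 0, 1; C-bar, V-bar, V
   in real variables 0, 1, 2; x, y, u in real arrays 0, 1, 2, addressed by
   their labels 1..T, 1..T, 2..T. All other memory is 0. *)
Definition input (R : realType) (p : params R) (z : point R (horizon p)) :
    state R :=
  State
    (nth 0%N [:: horizon p; uptime p])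
    (fun _ _ => 0%N)
    (nth 0 [:: cap p; startup p; ramp p])
    (nth (fun _ => 0) [:: xc z; yc z; uc z]).

(* Output convention. Natural variable 2 tells whether a violated inequality
   exists; if so, t, m, n are in natural variables 3, 4, 5, and natural array
   0 marks the elements of S by nonzero values. *)
Definition output_index (R : realType) (T : nat) (s : state R) : ineq_index T :=
  Index (nvar s 3) (nvar s 4) (nvar s 5)
        [set i : 'I_T.+1 | narr s 0 i != 0%N].

Definition separates (R : realType) (p : params R) (z : point R (horizon p))
    (s : state R) : Prop :=
  (nvar s 2 = 1%N /\ most_violated z (output_index (horizon p) s)) \/
  (nvar s 2 = 0%N /\ forall q, admissible q -> violation z q <= 0).

(* Main.v *)
(* For fixed t, m, n, put w_i = slack_i - slack_(t+n). The violation is then a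
   constant minus V times the sum over i in S of (i - d_i) w_i. Charging each
   j in (t-m, t] to the least element of S that is >= j turns this sum into
   the sum over j of w at that element (0 if there is none), which is at least
   the sum over j of min(0, w_j, ..., w_t). Equality holds for the set of strict
   records of w below 0 met when scanning down from t, so one linear scan solves
   the problem for (t, m, n), and O(T^2 L) triples are tried. *)
Require Import Defs.
From HB Require Import structures.
From mathcomp Require Import all_boot all_order all_algebra.
From mathcomp Require Import reals.
From mathcomp Require Import zify ring.

Set Implicit Arguments.
Unset Strict Implicit.
Unset Printing Implicit Defensive.

Import Order.TTheory GRing.Theory Num.Theory.
Local Open Scope ring_scope.

(** * Optimal choice of S *)

Section Chain.
Variables (R : realType) (T : nat).
Implicit Types (A : {set 'I_T.+1}) (w : nat -> R).

Lemma pred_in_lt A t m i : (t - m < i)%N -> (pred_in A t m i < i)%N.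
Proof.
move=> mi; rewrite /pred_in; apply: (@big_ind _ (fun x => x < i)%N); first lia.
- by move=> x y; rewrite gtn_max => -> ->.
- by move=> a /andP[].
Qed.

Lemma leq_pred_in A t m (i : nat) (a : 'I_T.+1) :
  a \in A -> (a < i)%N -> (a <= pred_in A t m i)%N.
Proof.
by move=> aA ai; apply: (@leq_bigmax_cond _ _ (fun x : 'I_T.+1 => x : nat)); rewrite aA ai.
Qed.

(** The index [t - m] always competes in the maximum, which therefore ranges over a nonempty set and
    is attained. *)
Lemma pred_in_or A t m i : (t <= T)%N -> (t - m < i)%N ->
  pred_in A t m i = (t - m)%N \/ inord (pred_in A t m i) \in A.
Proof.
move=> tT mi.
have lt : (t - m < T.+1)%N by lia.
have PM : ((Ordinal lt \in A) || (Ordinal lt == (t - m)%N :> nat)) && (Ordinal lt < i)%N.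
  by rewrite /= eqxx orbT.
pose P (a : 'I_T.+1) := ((a \in A) || (a == (t - m)%N :> nat)) && (a < i)%N.
have [|a Pa aE] := @eq_bigmax_cond _ P (fun a : 'I_T.+1 => a : nat).
  by apply/card_gt0P; exists (Ordinal lt).
have -> : pred_in A t m i = a by exact: aE.
case/andP: Pa => /orP[aA|/eqP ->] _; last by left.
by right; rewrite inord_val.
Qed.

(* [next_weight A w t k] is [w] at the least element of [A] in [(t - k, t]], and 0 if
   there is none. *)
Fixpoint next_weight A w t k : R :=
  if k is k'.+1 then
    if inord (t - k') \in A then w (t - k')%N else next_weight A w t k'
  else 0.

(** The intervals [d_i, i) for [i] in [A] are disjoint, so at most one term survives: that of the
    least element of [A] above [t - k]. The induction moves the threshold [t - k] down by one. *)
Lemma next_weightE A w t m k :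
  (t <= T)%N -> (m <= t)%N -> (k <= m)%N ->
  (forall i, i \in A -> (t - m < i <= t)%N) ->
  \sum_(i in A | (pred_in A t m i <= t - k < i)%N) w i = next_weight A w t k.
Proof.
move=> tT mt + hA; elim: k => [|k IHk] km /=.
  by rewrite big_pred0 // => i; apply/negbTE/negP => /andP[/hA]; lia.
have vk : (inord (t - k) : 'I_T.+1) = (t - k)%N :> nat by rewrite inordK //; lia.
case: ifPn => [kA|kA].
  rewrite (bigD1 (inord (t - k))) /=; last first.
    rewrite kA vk; have := @pred_in_lt A t m (t - k)%N; lia.
  rewrite vk big1 ?addr0 // => i /andP[/andP[iA /andP[pi ti]] ik].
  have ik' : (i != (t - k)%N :> nat) by rewrite -vk (inj_eq val_inj).
  have := @leq_pred_in A t m i _ kA; rewrite vk; lia.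
rewrite -IHk; last lia.
apply: eq_bigl => i; case iA: (i \in A) => //=.
have hi := hA _ iA.
have ik : (i != (t - k)%N :> nat).
  by apply: contraNneq kA => ik; rewrite -ik inord_val.
(* The predecessor lies in [A] or equals [t - m], while [t - k] is outside [A] and above [t - m]. *)
have hp : (pred_in A t m i != (t - k)%N :> nat).
  apply: contraNneq kA => pk; case: (@pred_in_or A t m i); [lia|lia| |by rewrite pk].
  lia.
have := @pred_in_lt A t m i; lia.
Qed.

(* Each [j] in [(t - m, t]] is charged to the least element of [A] above it. *)
Lemma chain_sum A w t m :
  (t <= T)%N -> (m <= t)%N -> (forall i, i \in A -> (t - m < i <= t)%N) ->
  \sum_(i in A) (i%:R - (pred_in A t m i)%:R) * w i =
  \sum_(0 <= k < m) next_weight A w t k.+1.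
Proof.
move=> tT mt hA.
transitivity (\sum_(0 <= k < m)
    \sum_(i in A | (pred_in A t m i <= t - k.+1 < i)%N) w i); last first.
  by apply: eq_big_nat => k /andP[_ km]; apply: next_weightE.
rewrite (exchange_big_dep (mem A)) //=; last by move=> k i _ /andP[].
apply: eq_bigr => i iA; have hi := hA _ iA.
have pi : (pred_in A t m i < i)%N by apply: pred_in_lt; lia.
have pm : (t - m <= pred_in A t m i)%N.
  have lt : (t - m < T.+1)%N by lia.
  apply: (@leq_bigmax_cond _ _ (fun x : 'I_T.+1 => x : nat) (Ordinal lt)).
  by rewrite /= eqxx orbT; lia.
rewrite big_const_seq iter_addr_0 -natrB ?mulr_natl; last lia.
congr (_ *+ _); rewrite iA /=.
move: (pred_in A t m i) pi pm => p pi pm.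
(* The indices [k] charged to [i] are those with [t - i <= k < t - p], the middle one of three
   consecutive runs, so there are [i - p] of them. *)
have -> : m = ((t - i) + ((i - p) + (m - (t - p))))%N by lia.
rewrite /index_iota subn0.
rewrite !iotaD !count_cat !add0n.
have in_count (P : pred nat) (s : seq nat) b : {in s, P =1 fun=> b} -> count P s = (b * size s)%N.
  move=> /eq_in_count ->; case: b; first by rewrite count_predT mul1n.
  by rewrite count_pred0.
rewrite (in_count _ _ false) ?(in_count _ (iota _ (i - p)) true) ?(in_count _ _ false) ?size_iota;
  try (by move=> k; rewrite mem_iota /=; lia).
lia.
Qed.

(* [min (0, w_t, ..., w_(t-k+1))] *)
Fixpoint sufmin w t k : R :=
  if k is k'.+1 then Num.min (w (t - k')%N) (sufmin w t k') else 0.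

(** Whatever [A] is, [next_weight] is one of the competitors in the minimum. *)
Lemma sufmin_le_next A w t k : sufmin w t k <= next_weight A w t k.
Proof.
elim: k => //= k IHk; case: ifP => _; first by rewrite ge_min lexx.
by rewrite ge_min IHk orbT.
Qed.

(** Here [A] holds the strict records met going down from [t]. Its least element so far is the place
    of the latest record, where the current minimum is attained; before the first record both sides
    are 0. *)
Lemma next_eq_sufmin A w t m :
  (forall k, (k < m)%N -> (inord (t - k) \in A) = (w (t - k)%N < sufmin w t k)) ->
  forall k, (k <= m)%N -> next_weight A w t k = sufmin w t k.
Proof.
move=> hA; elim=> //= k IHk km; rewrite hA // minEle IHk; last exact: ltnW.
by case: ltgtP => // ->.
Qed.

End Chain.

(** * Cost-bounded reachability *)

(* Locations are tagged: 0 and 1 for natural variables and arrays, 2 and 3 for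
   real ones. *)
Fixpoint writes (c : cmd) : seq (nat * nat) :=
  match c with
  | Skip => [::]
  | NAssign v _ => [:: (0, v)%N]
  | NSet a _ _ => [:: (1, a)%N]
  | RAssign v _ => [:: (2, v)%N]
  | RSet a _ _ => [:: (3, a)%N]
  | Seq c1 c2 | If _ c1 c2 => writes c1 ++ writes c2
  | While _ c1 => writes c1
  end.

Definition For v lo hi body :=
  Seq (NAssign v lo)
    (While (BNot (BNle hi (NVar v)))
      (Seq body (NAssign v (NAdd (NVar v) (NConst 1))))).

Definition Sum a v lo hi r :=
  Seq (RAssign a (RConst 0)) (For v lo hi (RAssign a (RAdd (RVar a) r))).

Section Hoare.
Context {R : realType}.
Implicit Types (s : state R) (c : cmd) (W : seq (nat * nat)).

(** An array is one location here, so facts about single cells of a written array must come from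
    postconditions. *)
Definition frame W s s' : Prop :=
  [/\ forall v, (0, v)%N \notin W -> nvar s' v = nvar s v,
      forall a, (1, a)%N \notin W -> narr s' a = narr s a,
      forall v, (2, v)%N \notin W -> rvar s' v = rvar s v &
      forall a, (3, a)%N \notin W -> rarr s' a = rarr s a].

Lemma frame_trans W s1 s2 s3 :
  frame W s1 s2 -> frame W s2 s3 -> frame W s1 s3.
Proof.
move=> [a1 a2 a3 a4] [b1 b2 b3 b4]; split=> v vW.
- by rewrite b1 ?a1.
- by rewrite b2 ?a2.
- by rewrite b3 ?a3.
- by rewrite b4 ?a4.
Qed.

Lemma frame_sub W W' s s' : {subset W <= W'} -> frame W s s' -> frame W' s s'.
Proof.
move=> WW [f1 f2 f3 f4].
have N x : x \notin W' -> x \notin W by apply: contra => /WW.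
by split=> v /N; [exact: f1|exact: f2|exact: f3|exact: f4].
Qed.

Lemma exec_frame c s s' k : exec c s s' k -> frame (writes c) s s'.
Proof.
elim=> {c s s' k} //=.
- by move=> s v e; split=> // w; rewrite inE xpair_eqE /= /upd => /negbTE ->.
- by move=> s v i e; split=> // w; rewrite inE xpair_eqE /= /upd2 /upd => /negbTE ->.
- by move=> s v e; split=> // w; rewrite inE xpair_eqE /= /upd => /negbTE ->.
- by move=> s v i e; split=> // w; rewrite inE xpair_eqE /= /upd2 /upd => /negbTE ->.
- move=> s1 s2 s3 c1 c2 _ _ _ f1 _ f2.
  apply: (@frame_trans _ s1 s2); [apply: frame_sub f1|apply: frame_sub f2] => x xW.
    by rewrite mem_cat xW.
  by rewrite mem_cat xW orbT.
- by move=> s s' b c1 c2 _ _ _; apply: frame_sub => x xW; rewrite mem_cat xW.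
- by move=> s s' b c1 c2 _ _ _; apply: frame_sub => x xW; rewrite mem_cat xW orbT.
- by move=> s1 s2 s3 b c _ _ _ _ f1 _ f2; apply: frame_trans f1 f2.
Qed.

(** Total correctness with a step bound. An upper bound instead of the exact count lets the branches
    of a conditional and the passes of a loop share one figure. *)
Definition reach c s (K : nat) (Q : state R -> Prop) : Prop :=
  exists s' k, [/\ exec c s s' k, (k <= K)%N & Q s'].

(** Postconditions may rely on everything the program text cannot write, so invariants need not
    repeat it. *)
Lemma reach_frame c s K Q : reach c s K (fun s' => frame (writes c) s s' -> Q s') ->
  reach c s K Q.
Proof.
by move=> [s' [k [e kK q]]]; exists s', k; split=> //; apply: q; apply: exec_frame e.
Qed.

Lemma reach_weaken c s K K' (Q Q' : state R -> Prop) : reach c s K Q ->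
  (K <= K')%N -> (forall s', frame (writes c) s s' -> Q s' -> Q' s') ->
  reach c s K' Q'.
Proof.
move=> [s' [k [e kK q]]] KK qq; exists s', k; split=> //.
  exact: leq_trans kK KK.
by apply: qq => //; apply: exec_frame e.
Qed.

Lemma reach_leq c s K K' Q : reach c s K Q -> (K <= K')%N -> reach c s K' Q.
Proof. by move=> h KK; apply: reach_weaken h KK _. Qed.

Lemma reach_seq c1 c2 s K1 K2 Q :
  reach c1 s K1 (fun s1 => reach c2 s1 K2 Q) -> reach (Seq c1 c2) s (K1 + K2) Q.
Proof.
move=> [s1 [k1 [e1 kK1 [s2 [k2 [e2 kK2 q]]]]]]; exists s2, (k1 + k2)%N.
by split=> //; [apply: ExecSeq e1 e2|apply: leq_add].
Qed.

Lemma reach_step c1 c2 s K1 K2 (P Q : state R -> Prop) :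
  reach c1 s K1 P ->
  (forall s1, frame (writes c1) s s1 -> P s1 -> reach c2 s1 K2 Q) ->
  reach (Seq c1 c2) s (K1 + K2) Q.
Proof. by move=> h1 h2; apply: reach_seq; apply: reach_weaken h1 _ h2. Qed.

Lemma reach_if b c1 c2 s K1 K2 Q :
  (beval s b -> reach c1 s K1 Q) -> (~~ beval s b -> reach c2 s K2 Q) ->
  reach (If b c1 c2) s (bcost b + maxn K1 K2) Q.
Proof.
move=> h1 h2; case: (boolP (beval s b)) => hb.
  have [s' [k [e kK q]]] := h1 hb; exists s', (bcost b + k)%N.
  by split=> //; [apply: ExecIfTrue|lia].
have [s' [k [e kK q]]] := h2 hb; exists s', (bcost b + k)%N.
by split=> //; [apply: ExecIfFalse|lia].
Qed.

Lemma reach_skip s (Q : state R -> Prop) : Q s -> reach Skip s 1 Q.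
Proof. by move=> q; exists s, 1%N; split=> //; exact: ExecSkip. Qed.

Lemma reach_nassign s v e (Q : state R -> Prop) :
  Q (set_nvar s v (neval s e)) -> reach (NAssign v e) s (ncost e).+1 Q.
Proof. by move=> q; eexists _, _; split; [exact: ExecNAssign| |]. Qed.

Lemma reach_nset s a i e (Q : state R -> Prop) :
  Q (set_narr s a (neval s i) (neval s e)) ->
  reach (NSet a i e) s (ncost i + ncost e).+1 Q.
Proof. by move=> q; eexists _, _; split; [exact: ExecNSet| |]. Qed.

Lemma reach_rassign s v r (Q : state R -> Prop) :
  Q (set_rvar s v (reval s r)) -> reach (RAssign v r) s (rcost r).+1 Q.
Proof. by move=> q; eexists _, _; split; [exact: ExecRAssign| |]. Qed.

Lemma reach_rset s a i r (Q : state R -> Prop) :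
  Q (set_rarr s a (neval s i) (reval s r)) ->
  reach (RSet a i r) s (ncost i + rcost r).+1 Q.
Proof. by move=> q; eexists _, _; split; [exact: ExecRSet| |]. Qed.

(** The invariant is asked after the counter has been advanced, and frames are relative to the state
    [s0] before the loop. The final index is [maxn l h] since an empty range makes no pass. A pass
    costs [ncost hi + 3] for the test, [K] for the body and 4 for the increment, rounded up. *)
Lemma reach_for v lo hi body s0 K l h (I : nat -> state R -> Prop) Q :
  neval s0 lo = l ->
  (forall s, frame (writes (For v lo hi body)) s0 s -> neval s hi = h) ->
  (0, v)%N \notin writes body ->
  I l (set_nvar s0 v l) ->
  (forall j s, (l <= j < h)%N -> frame (writes (For v lo hi body)) s0 s ->
     nvar s v = j -> I j s ->
     reach body s K (fun s' => I j.+1 (set_nvar s' v j.+1))) ->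
  (forall s, frame (writes (For v lo hi body)) s0 s -> I (maxn l h) s -> Q s) ->
  reach (For v lo hi body) s0
    ((ncost lo).+1 + (h - l) * (ncost hi + K + 8) + ncost hi + 3) Q.
Proof.
set W := writes _ => lo_l hi_h vbody I0 Istep Iend.
rewrite -addnA -addnA; apply/reach_seq/reach_nassign; rewrite lo_l.
set b := BNot _; set bd := Seq body _.
(* Induction on the number [d] of passes still to be made. *)
have loop j s d : (d = h - j)%N -> (l <= j)%N -> (j <= maxn l h)%N ->
    frame W s0 s -> nvar s v = j -> I j s ->
    reach (While b bd) s (d * (ncost hi + K + 8) + (ncost hi + 3))
      (fun s' => frame W s0 s' /\ I (maxn l h) s').
  elim: d j s => [|d IHd] j s dE lj jm fs vj Ij.
    exists s, (bcost b); split.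
    - by apply: ExecWhileFalse; rewrite /= (hi_h s fs) vj negbK; lia.
    - by rewrite /=; lia.
    - by split=> //; have -> : maxn l h = j by lia.
  have jh : (l <= j < h)%N by lia.
  have [s1 [k1 [e1 kK1 I1]]] := Istep j s jh fs vj Ij.
  have v1 : nvar s1 v = j by have [-> //] := exec_frame e1.
  pose s2 := set_nvar s1 v j.+1.
  have e2 : exec bd s s2 (k1 + 4).
    apply: ExecSeq e1 _.
    have -> : s2 = set_nvar s1 v (neval s1 (NAdd (NVar v) (NConst 1))).
      by rewrite /= v1 addn1.
    exact: ExecNAssign.
  have fs2 : frame W s0 s2.
    apply: frame_trans fs _.
    by apply: frame_sub (exec_frame e2) => x; rewrite /W /= inE => ->; rewrite orbT.
  have [||||s3 [k3 [e3 kK3 q]]] := IHd j.+1 s2 _ _ _ fs2 _ I1.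
  - lia.
  - lia.
  - lia.
  - by rewrite /s2 /= /upd eqxx.
  exists s3, (bcost b + (k1 + 4) + k3)%N; split=> //.
    by apply: ExecWhileTrue e2 e3; rewrite /= (hi_h s fs) vj; lia.
  by rewrite /=; lia.
have fs0 : frame W s0 (set_nvar s0 v l).
  by split=> //= w; rewrite /W /= inE xpair_eqE /= negb_or /upd => /andP[/negbTE ->].
have := loop l (set_nvar s0 v l) (h - l)%N erefl (leqnn _) (leq_maxl _ _) fs0.
rewrite /= /upd eqxx => /(_ erefl I0) lp.
by apply: reach_weaken lp (leqnn _) _ => s' _ [fs Is]; apply: Iend.
Qed.

(** The hypothesis on [r] covers every state that differs from [s0] only in locations the sum
    writes, so the summand may depend on the counter but not on the accumulator. *)
Lemma reach_sum a v lo hi r s0 l h (F : nat -> R) (Q : state R -> Prop) :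
  neval s0 lo = l ->
  (forall s, frame (writes (Sum a v lo hi r)) s0 s -> neval s hi = h) ->
  (forall j s, (l <= j < h)%N -> frame (writes (Sum a v lo hi r)) s0 s ->
     nvar s v = j -> reval s r = F j) ->
  (forall s, frame (writes (Sum a v lo hi r)) s0 s ->
     rvar s a = \sum_(l <= j < h) F j -> Q s) ->
  reach (Sum a v lo hi r) s0
    (2 + ((ncost lo).+1 + (h - l) * (ncost hi + (1 + rcost r).+2 + 8) + ncost hi + 3)) Q.
Proof.
set W := writes _ => lo_l hi_h rF q.
have W0 s : frame (writes (For v lo hi (RAssign a (RAdd (RVar a) r)))) (set_rvar s0 a 0) s ->
    frame W s0 s.
  move=> fs; apply: frame_trans (_ : frame W s0 (set_rvar s0 a 0)) _.
    by split=> //= w; rewrite /W /= inE xpair_eqE negb_or /upd => /andP[/negbTE /= ->].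
  by apply: frame_sub fs => x xx; rewrite /W in_cons; apply/orP; right.
apply/reach_seq/reach_rassign.
apply: (@reach_for v lo hi _ _ _ l h (fun j s => rvar s a = \sum_(l <= i < j) F i)).
(* Natural expressions read no real memory, so resetting the accumulator does not change the lower
   limit. *)
- rewrite -lo_l; elim: lo {lo_l hi_h rF q W W0} => //=.
  + by move=> b e ->.
  + by move=> e1 -> e2 ->.
  + by move=> e1 -> e2 ->.
- by move=> s /W0; exact: hi_h.
- by [].
- by rewrite big_geq //= /upd eqxx.
- move=> j s lj /W0 fs vj Is; apply: reach_rassign; rewrite /= /upd eqxx Is.
  by rewrite (rF j) // big_nat_recr //=; case/andP: lj.
- move=> s /W0 fs Is; apply: q => //; rewrite Is.
  by case: (leqP l h) => // hl; rewrite !big_geq // ltnW.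
Qed.

End Hoare.

(** * Evaluating one triple (t, m, n) *)

Section BestChain.
Variables (R : realType) (p : params R) (z : point R (horizon p)).
Implicit Types t m n : nat.

(** The weight w_i: the sum over S inside [alpha] multiplies [slack z (t + n)] and is absorbed
    here. *)
Definition gap t n (i : nat) : R := slack z i - slack z (t + n)%N.

(** What the violation becomes for an optimal S, the suffix minima replacing the sum over S. *)
Definition best_violation t m n : R :=
  xc z t - (startup p * yc z t
    + ramp p * (\sum_(1 <= k < (n - 1).+1) slack z (t + k)%N)
    + (m%:R + (uptime p)%:R - 1 - (n - 1)%:R) * ramp p * slack z (t + n)%N
    + beta p m * slack z (t - m)%N + phi z t
    + ramp p * (\sum_(0 <= k < m) sufmin (gap t n) t k.+1)).

(** Isolates the dependence on [A] in one sum, whose terms are nonnegative and all vanish when [A]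
    consists of the strict records. *)
Lemma violationE t m n (A : {set 'I_(horizon p).+1}) :
  (t <= horizon p)%N -> (m <= t)%N -> (forall i, i \in A -> (t - m < i <= t)%N) ->
  violation z (Index t m n A) = best_violation t m n
    - ramp p * (\sum_(0 <= k < m)
        (next_weight A (gap t n) t k.+1 - sufmin (gap t n) t k.+1)).
Proof.
move=> tT mt hA; rewrite sumrB /violation /best_violation /= -chain_sum //.
have -> : \sum_(i in A) (i%:R - (pred_in A t m i)%:R) * gap t n i =
    \sum_(i in A) (i%:R - (pred_in A t m i)%:R) * slack z i
    - (\sum_(i in A) (i%:R - (pred_in A t m i)%:R)) * slack z (t + n)%N.
  by rewrite mulr_suml -sumrB; apply: eq_bigr => i _; rewrite mulrBr.
ring.
Qed.

Lemma violation_le t m n (A : {set 'I_(horizon p).+1}) :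
  0 < ramp p ->
  (t <= horizon p)%N -> (m <= t)%N -> (forall i, i \in A -> (t - m < i <= t)%N) ->
  violation z (Index t m n A) <= best_violation t m n.
Proof.
move=> V0 tT mt hA; rewrite violationE // gerBl mulr_ge0 ?(ltW V0) //.
by apply: sumr_ge0 => k _; rewrite subr_ge0 sufmin_le_next.
Qed.

Lemma violation_greedy t m n (A : {set 'I_(horizon p).+1}) :
  (t <= horizon p)%N -> (m <= t)%N -> (forall i, i \in A -> (t - m < i <= t)%N) ->
  (forall k, (k < m)%N -> (inord (t - k) \in A) =
    (gap t n (t - k) < sufmin (gap t n) t k)) ->
  violation z (Index t m n A) = best_violation t m n.
Proof.
move=> tT mt hA gA; rewrite violationE // big_nat big1 ?mulr0 ?subr0 // => k km.
by rewrite (next_eq_sufmin gA) ?subrr.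
Qed.

End BestChain.

(* Natural variables 6, 7, 8 hold t, m, n; real array 3 is the conversion table
   from naturals to reals, real array 4 holds the slacks, and real variable 3
   holds [mbound]. *)
Definition sum_slack :=
  Sum 7 9 (NConst 1) (NAdd (NSub (NVar 8) (NConst 1)) (NConst 1))
    (RGet 4 (NAdd (NVar 6) (NVar 9))).
(** Truncated subtraction yields [t + L - T]^+, where the two sums of [phi] meet. *)
Definition cT1 := NSub (NAdd (NVar 6) (NVar 1)) (NVar 0).
Definition phi1 :=
  Sum 5 9 (NConst 1) cT1
    (RMul (RGet 3 (NVar 9)) (RGet 2 (NSub (NVar 6) (NVar 9)))).
(** With truncated subtraction, a - (a - k) is the minimum of a and k. *)
Definition phi2 :=
  let a := NSub (NSub (NVar 1) (NConst 1)) (NVar 9) in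
  Sum 6 9 cT1 (NVar 1)
    (RMul (RGet 3 (NSub a (NSub a (NVar 9)))) (RGet 2 (NSub (NVar 6) (NVar 9)))).
(* Real variable 8 is the running minimum [sufmin] and real variable 9 the sum
   of its values; natural array 0 marks the strict records. *)
Definition scan :=
  let i := NSub (NVar 6) (NVar 9) in
  let w := RSub (RGet 4 i) (RGet 4 (NAdd (NVar 6) (NVar 8))) in
  Seq (RAssign 8 (RConst 0)) (Seq (RAssign 9 (RConst 0))
    (For 9 (NConst 0) (NVar 7)
      (Seq (If (BRle (RVar 8) w) (NSet 0 i (NConst 0))
              (Seq (RAssign 8 w) (NSet 0 i (NConst 1))))
           (RAssign 9 (RAdd (RVar 9) (RVar 8)))))).
(** Bracketed like [best_violation], so that their agreement needs no algebra. *)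
Definition value :=
  let V := RVar 2 in
  let mL := RSub (RAdd (RGet 3 (NVar 7)) (RGet 3 (NVar 1))) (RConst 1) in
  RSub (RGet 0 (NVar 6))
    (RAdd (RAdd (RAdd (RAdd (RAdd
      (RMul (RVar 1) (RGet 1 (NVar 6)))
      (RMul V (RVar 7)))
      (RMul (RMul (RSub mL (RGet 3 (NSub (NVar 8) (NConst 1)))) V)
        (RGet 4 (NAdd (NVar 6) (NVar 8)))))
      (RMul (RSub (RSub (RVar 0) (RVar 1)) (RMul mL V))
        (RGet 4 (NSub (NVar 6) (NVar 7)))))
      (RAdd (RMul V (RVar 5)) (RMul V (RVar 6))))
      (RMul V (RVar 9))).
Definition evaluate :=
  Seq phi1 (Seq phi2 (Seq sum_slack (Seq scan (RAssign 10 value)))).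

(* The locations that stay fixed once the tables are built. *)
Definition ground : seq (nat * nat) :=
  [:: (0, 0); (0, 1); (2, 0); (2, 1); (2, 2); (2, 3);
      (3, 0); (3, 1); (3, 2); (3, 3); (3, 4)]%N.

(** * Correctness and linear cost of the evaluation *)

Section Evaluate.
Variables (R : realType) (p : params R) (z : point R (horizon p)).
Hypothesis (LT : (uptime p <= horizon p)%N).
Implicit Types (s : state R) (t m n : nat).
Let T := horizon p.
Let L := uptime p.

Record env s : Prop := Env {
  env_T : nvar s 0 = T;
  env_L : nvar s 1 = L;
  env_cap : rvar s 0 = cap p;
  env_startup : rvar s 1 = startup p;
  env_ramp : rvar s 2 = ramp p;
  env_mbound : rvar s 3 = mbound p;
  env_x : rarr s 0 = xc z;
  env_y : rarr s 1 = yc z;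
  env_u : rarr s 2 = uc z;
  env_nat : forall k, (k <= T)%N -> rarr s 3 k = k%:R;
  env_slack : forall i, (i <= T)%N -> rarr s 4 i = slack z i }.

Lemma env_frame W s s' :
  ~~ has (mem ground) W -> frame W s s' -> env s -> env s'.
Proof.
move=> /hasPn gW [f1 f2 f3 f4].
have gN x : x \in ground -> x \notin W.
  by move=> xg; apply/negP => /gW; rewrite inE xg.
move=> [e1 e2 e3 e4 e5 e6 e7 e8 e9 e10 e11].
by split; rewrite ?(f1 _ (gN _ _)) ?(f3 _ (gN _ _)) ?(f4 _ (gN _ _)).
Qed.

Definition at_index t m n s := [/\ nvar s 6 = t, nvar s 7 = m & nvar s 8 = n].

(** The condition on [W] is decided by computation, so concrete programs discharge it by [isT]. *)
Lemma ready_frame W t m n s s' :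
  frame W s s' -> env s /\ at_index t m n s ->
  ~~ has (mem [:: (0, 6), (0, 7), (0, 8) & ground]%N) W ->
  env s' /\ at_index t m n s'.
Proof.
move=> fs [es [e1 e2 e3]] gW; split.
  apply: env_frame fs es; apply: contra gW => /hasP[x xW xg]; apply/hasP; exists x => //.
  by rewrite /= 3!in_cons (xg : x \in ground) !orbT.
have [f1 _ _ _] := fs; move/hasPn: gW => gW.
by split; rewrite f1 //; apply/negP => /gW.
Qed.

(** Cells outside the window keep their old marks, so they must be clear beforehand for the marks to
    describe an admissible S. *)
Lemma reach_scan t m n s (Q : state R -> Prop) :
  (t <= T)%N -> (m <= t)%N -> (t + n <= T)%N -> env s -> at_index t m n s ->
  (forall s', frame (writes scan) s s' ->
     rvar s' 9 = \sum_(0 <= k < m) sufmin (gap z t n) t k.+1 ->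
     (forall k, (k < m)%N ->
        narr s' 0 (t - k)%N = (gap z t n (t - k) < sufmin (gap z t n) t k)) ->
     (forall i, ~~ (t - m < i <= t)%N -> narr s' 0 i = narr s 0 i) -> Q s') ->
  reach scan s (100 * (m + 1)) Q.
Proof.
move=> tT mt nT es ats q.
apply: (@reach_weaken _ _ _ _ _ (fun s' => 
     rvar s' 9 = \sum_(0 <= k < m) sufmin (gap z t n) t k.+1 /\
     (forall k, (k < m)%N ->
        narr s' 0 (t - k)%N = (gap z t n (t - k) < sufmin (gap z t n) t k)) /\
     (forall i, ~~ (t - m < i <= t)%N -> narr s' 0 i = narr s 0 i))); last first.
- by move=> s' fs [h1 [h2 h3]]; apply: q.
(* The step count stays an existential variable, built up by the composition rules and compared with
   the bound at the end. *)
- shelve.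
apply/reach_seq/reach_rassign/reach_seq/reach_rassign.
set s1 := set_rvar _ _ _.
have [at1 at2 at3] := ats.
(* After [k] passes the top [k] cells are decided. Each is compared with the minimum of 0 and the
   gaps above it, and a tie leaves it unmarked. *)
apply: (@reach_for _ _ _ _ _ _ _ 0%N m (fun k s' =>
  [/\ rvar s' 8 = sufmin (gap z t n) t k,
      rvar s' 9 = \sum_(0 <= j < k) sufmin (gap z t n) t j.+1,
      (forall j, (j < k)%N ->
        narr s' 0 (t - j)%N = (gap z t n (t - j) < sufmin (gap z t n) t j)) &
      (forall i, ~~ (t - k < i <= t)%N -> narr s' 0 i = narr s 0 i)])) => //.
- by move=> s' [/= ->].
- by split=> //; rewrite ?big_geq.
- move=> k s' km fs' vk [I1 I2 I3 I4].
  have [es' [a1 a2 a3]] : env s' /\ at_index t m n s'.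
    by apply: ready_frame fs' _ _ => //; split=> //; case: es; split.
  apply: (@reach_step _ _ _ _ _ _ (fun s2 =>
     rvar s2 8 = sufmin (gap z t n) t k.+1 /\
     narr s2 0 = upd (narr s' 0) (t - k)%N
       (nat_of_bool (gap z t n (t - k) < sufmin (gap z t n) t k)))); last first.
    move=> s2 [_ _ f2 _] [J1 J2].
    apply: reach_rassign; rewrite /= /upd /= J1 (f2 9) // I2 J2.
    split=> //; first by rewrite big_nat_recr.
    * move=> j jk; rewrite /upd; case: eqP => [jk'|jk'].
        by have -> : j = k by lia.
      apply: I3; have : j != k by apply: contra_not_neq jk' => ->. lia.
    * move=> i ti; rewrite /upd; case: eqP => [?|?]; first lia.
      apply: I4; lia.
  apply: reach_if => /=;
    rewrite a1 a3 vk !(env_slack es') ?I1 -?/(gap z t n _); try lia.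
    move=> h; apply: reach_nset; rewrite /= a1 vk I1.
    by rewrite minElt ltNge h.
  rewrite -ltNge => h.
  apply/reach_seq/reach_rassign/reach_nset; rewrite /= a1 vk /upd /= a3.
  rewrite !(env_slack es') -?/(gap z t n _); try lia.
  by rewrite minElt h.
- move=> s' fs' []; rewrite max0n; split=> //.
Unshelve.
rewrite /=; lia.
Qed.

(** Four linear passes, of lengths at most [L], [L], [n] and [m]. The condition [t + n <= T] keeps
    every slack that is read inside the table. *)
Lemma reach_evaluate t m n s (Q : state R -> Prop) :
  (t <= T)%N -> (m <= t)%N -> (t + n <= T)%N -> env s -> at_index t m n s ->
  (forall s', frame (writes evaluate) s s' ->
     rvar s' 10 = best_violation z t m n ->
     (forall k, (k < m)%N ->
        narr s' 0 (t - k)%N = (gap z t n (t - k) < sufmin (gap z t n) t k)) ->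
     (forall i, ~~ (t - m < i <= t)%N -> narr s' 0 i = narr s 0 i) -> Q s') ->
  reach evaluate s (300 * (T + 1)) Q.
Proof.
move=> tT mt nT es ats q.
apply: reach_frame; apply: reach_leq.
apply: reach_seq.
apply: (@reach_sum _ _ _ _ _ _ _ 1 (t + L - T) (fun k => k%:R * uc z (t - k))) => //.
- by move=> s1 /= /ready_frame/(_ (conj es ats) isT) [[-> -> _ _ _ _ _ _ _ _ _] [-> _ _]].
- move=> k s1 kl /ready_frame/(_ (conj es ats) isT) [[_ _ _ _ _ _ _ _ eu en _] [a1 _ _]] vk.
  by rewrite /= a1 vk en ?eu //; lia.
move=> s1 f1 s15; have [es1 ats1] := ready_frame f1 (conj es ats) isT.
apply: reach_seq.
apply: (@reach_sum _ _ _ _ _ _ _ (t + L - T) L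
  (fun k => (minn (L - 1 - k) k)%:R * uc z (t - k))).
- by case: es1 ats1 => /= -> -> _ _ _ _ _ _ _ _ _ [-> _ _].
- by move=> s2 /= /ready_frame/(_ (conj es1 ats1) isT) [[_ -> _ _ _ _ _ _ _ _ _] _].
- move=> k s2 kl /ready_frame/(_ (conj es1 ats1) isT) [[_ eL _ _ _ _ _ _ eu en _] [a1 _ _]] vk.
  rewrite /= a1 vk eL eu; congr (_ * _).
  rewrite minnE -en //; lia.
move=> s2 f2 s26; have [es2 ats2] := ready_frame f2 (conj es1 ats1) isT.
apply: reach_seq.
apply: (@reach_sum _ _ _ _ _ _ _ 1 (n - 1).+1 (fun k => slack z (t + k))) => //.
- by move=> s3 /ready_frame/(_ (conj es2 ats2) isT) [_ [_ _ /= ->]]; rewrite addn1.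
- move=> k s3 kl /ready_frame/(_ (conj es2 ats2) isT) [e3 [a1 _ _]] vk.
  by rewrite /= a1 vk (env_slack e3) //; lia.
move=> s3 f3 s37; have [es3 ats3] := ready_frame f3 (conj es2 ats2) isT.
apply: reach_seq; apply: (@reach_scan t m n) => // s4 f4 s49 g4 o4.
have [es4 [a1 a2 a3]] := ready_frame f4 (conj es3 ats3) isT.
apply: reach_rassign => fs; apply: q => //.
- rewrite /= /upd /= a1 a2 a3 s49.
  have -> : rvar s4 5 = \sum_(1 <= k < t + L - T) k%:R * uc z (t - k)%N.
    by rewrite -s15; case: f4 => _ _ -> //; case: f3 => _ _ -> //; case: f2 => _ _ ->.
  have -> : rvar s4 6 =
      \sum_(t + L - T <= k < L) (minn (L - 1 - k) k)%:R * uc z (t - k)%N.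
    by rewrite -s26; case: f4 => _ _ -> //; case: f3 => _ _ ->.
  have -> : rvar s4 7 = \sum_(1 <= k < (n - 1).+1) slack z (t + k)%N.
    by rewrite -s37; case: f4 => _ _ ->.
  case: es4 => _ -> -> -> -> _ -> -> _ en eS.
  rewrite !en ?eS; try lia.
  rewrite /best_violation /phi /beta -/T -/L; by [].
- move=> i hi; rewrite /= o4 //.
  case: f3 => _ -> // _ _; case: f2 => _ -> // _ _; by case: f1 => _ -> // _ _.
rewrite /=; lia.
Qed.

End Evaluate.

(** * The separation algorithm *)

Definition horizon1 := NAdd (NVar 0) (NConst 1).
(** The machine cannot convert naturals to reals, so the reals 0, ..., T are produced by repeatedly
    adding 1. *)
Definition nat_table :=
  Seq (RAssign 12 (RConst 0))
    (For 9 (NConst 0) horizon1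
      (Seq (RSet 3 (NVar 9) (RVar 12)) (RAssign 12 (RAdd (RVar 12) (RConst 1))))).
Definition m_bound :=
  Seq (RAssign 3 (RAdd (RSub (RDiv (RSub (RVar 0) (RVar 1)) (RVar 2))
                         (RGet 3 (NVar 1))) (RConst 1)))
    (If (BRle (RConst 0) (RVar 3)) Skip (RAssign 3 (RConst 0))).
Definition slack_table :=
  For 10 (NConst 0) horizon1
    (Seq (Sum 12 9 (NConst 0) (NVar 1) (RGet 2 (NSub (NVar 10) (NVar 9))))
         (RSet 4 (NVar 10) (RSub (RGet 1 (NVar 10)) (RVar 12)))).
Definition setup := Seq nat_table (Seq m_bound slack_table).

Definition BOr b1 b2 := BNot (BAnd (BNot b1) (BNot b2)).

Definition guard :=
  let Tt := NSub (NVar 0) (NVar 6) in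
  BAnd (BNle (NAdd (NVar 1) (NConst 1)) (NVar 6))
  (BAnd (BNle (NVar 7) (NSub (NSub (NVar 6) (NVar 1)) (NConst 1)))
  (BAnd (BRle (RGet 3 (NVar 7)) (RVar 3))
  (BAnd (BOr (BNle (NVar 1) (NConst 1)) (BOr (BNle (NConst 1) (NVar 8)) (BNle Tt (NVar 8))))
  (BAnd (BNle (NVar 8) Tt)
        (BOr (BNle Tt (NVar 8)) (BNle (NSub (NVar 1) (NConst 1)) (NAdd (NVar 8) (NVar 8)))))))).
(** Real variable 4 is initially 0, so only positive violations are ever recorded. *)
Definition update :=
  If (BRle (RVar 10) (RVar 4)) Skip
    (Seq (RAssign 4 (RVar 10)) (Seq (NAssign 2 (NConst 1))
      (Seq (NAssign 3 (NVar 6)) (Seq (NAssign 4 (NVar 7)) (NAssign 5 (NVar 8)))))).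
Definition attempt := If guard (Seq evaluate update) Skip.
(** The loops run over a whole box, which [guard] filters: the limit on m is a real number and
    cannot serve as a loop limit. *)
Definition search :=
  For 6 (NConst 0) horizon1 (For 7 (NConst 0) horizon1 (For 8 (NConst 0) (NVar 1) attempt)).
Definition clear_marks :=
  For 9 (NConst 0) horizon1 (NSet 0 (NVar 9) (NConst 0)).
(* The marks of the last scan need not belong to the best triple, so the latter
   is evaluated again. *)
Definition recover :=
  If (BNle (NConst 1) (NVar 2))
    (Seq clear_marks
      (Seq (NAssign 6 (NVar 3)) (Seq (NAssign 7 (NVar 4)) (Seq (NAssign 8 (NVar 5))
        evaluate)))) Skip.
Definition separation := Seq setup (Seq search recover).

(** * Correctness and cost of setup, search and recovery *)

Section Separation.
Variables (R : realType) (p : params R) (z : point R (horizon p)).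
Hypothesis (LT : (uptime p <= horizon p)%N).
Implicit Types (s : state R) (t m n : nat).
Let T := horizon p.
Let L := uptime p.

Lemma reach_nat_table : reach nat_table (input z) (100 * (T + 1))
  (fun s => forall k, (k <= T)%N -> rarr s 3 k = k%:R).
Proof.
apply: reach_leq; [apply/reach_seq/reach_rassign|shelve].
apply: (@reach_for _ _ _ _ _ _ _ 0 T.+1 (fun j s => rvar s 12 = j%:R /\
   forall k, (k < j)%N -> rarr s 3 k = k%:R)) => //.
- by move=> s [f _ _ _]; rewrite /= f //= addn1.
- move=> j s _ _ vj [I1 I2]; apply/reach_seq/reach_rset/reach_rassign.
  rewrite /= vj I1; split=> [|k kj]; rewrite /upd2 /upd /=.
    by rewrite -natrD addn1.
  case: (eqVneq k j) => [->//|kj']; apply: I2; lia.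
- by move=> s _ [_ I2] k kT; apply: I2; rewrite max0n.
Unshelve.
rewrite /=; lia.
Qed.

Lemma reach_setup : reach setup (input z) (1000 * (T + 1) * (L + 1)) (env z).
Proof.
apply: reach_leq; [apply: reach_step reach_nat_table _|shelve].
move=> s1 [n1 _ r1 a1] en1.
apply: (@reach_step _ _ _ _ _ _ (fun s => rvar s 3 = mbound p)).
  apply/reach_seq/reach_rassign/reach_if => /=.
    rewrite /upd /= !r1 //= n1 //= en1 // => h; apply: reach_skip => /=.
    by rewrite /upd /mbound; apply/esym/max_idPl.
  rewrite /upd /= !r1 //= n1 //= en1 // -ltNge => h; apply: reach_rassign => /=.
  by rewrite /upd /= /mbound; apply/esym/max_idPr/ltW.
move=> s2 [n2 _ r2 a2] mb2.
have en2 k : (k <= T)%N -> rarr s2 3 k = k%:R by rewrite a2 //; exact: en1.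
apply: (@reach_for _ _ _ _ _ _ _ 0 T.+1 (fun j s =>
   forall k, (k < j)%N -> rarr s 4 k = slack z k)) => //.
- by move=> s [f _ _ _]; rewrite /= f // n2 // n1 //= addn1.
- move=> i s iT fs vi I1; apply: reach_seq.
  apply: (@reach_sum _ _ _ _ _ _ _ 0 L (fun j => uc z (i - j)%N)) => //.
  + by move=> s3 [f _ _ _]; case: fs => g _ _ _; rewrite /= f // g // n2 // n1.
  + move=> j s3 _ [f3 _ _ b3] vj; case: fs => f _ _ b.
    by rewrite /= b3 // b // a2 // a1 // f3 // vi vj.
  move=> s3 [f3 _ _ b3] s12; case: fs => f _ _ b.
  apply: reach_rset; rewrite /= s12 f3 // vi b3 // b // a2 // a1 //= => k ki.
  rewrite /upd2 /upd /=; case: eqP => [->//|kj']; rewrite b3 //; apply: I1; lia.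
- move=> s [f _ r b]; rewrite max0n => I1.
  split=> [|||||||||k kT|]; last exact: I1.
  10: by rewrite b ?en2.
  1,2: by rewrite f ?n2 ?n1.
  1-3: by rewrite r ?r2 ?r1.
  1: by rewrite r.
  all: by rewrite b ?a2 ?a1.
Unshelve.
rewrite /=; nia.
Qed.

(** Admissibility without the clause on S. The bound [n < L] gives [n = 0] when L = 1 and
    [n <= L - 1] otherwise; the first disjunction is the lower bound min{1, T - t} on n for L >=
    2. *)
Definition candidate t m n :=
  [&& (t <= T)%N, (n < L)%N, (L + 1 <= t)%N, (m <= t - L - 1)%N, m%:R <= mbound p,
   [|| (L <= 1)%N, (0 < n)%N | (T - t <= n)%N], (n <= T - t)%N &
   (T - t <= n)%N || (L - 1 <= n + n)%N].

Lemma admissibleP t m n (A : {set 'I_T.+1}) : (0 < L)%N ->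
  admissible (Index t m n A : ineq_index (horizon p)) <->
  candidate t m n /\ forall i : 'I_T.+1, i \in A -> (t - m < i <= t)%N.
Proof.
(* The only comparison of reals is abstracted to a boolean; the rest is integer arithmetic. *)
move=> L0; rewrite /admissible /candidate -/T -/L; move: (m%:R <= mbound p) => b; split.
  move=> [h1 [h2 ->] h4 h5 h6]; split; last by move=> i /h6; lia.
  by move: h4; case: ifP => h4 hn; lia.
move=> [h h9]; split; first lia.
- by split; lia.
- by case: ifP => hL; lia.
- lia.
- by move=> i /h9; lia.
Qed.

(* Real variable 4 holds the largest positive violation met so far among the
   triples in [D], and 0 if there is none. *)
Definition record (D : nat -> nat -> nat -> Prop) s :=
  (forall t m n, D t m n -> candidate t m n -> best_violation z t m n <= rvar s 4) /\
  (nvar s 2 = 0%N /\ rvar s 4 = 0 \/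
   [/\ nvar s 2 = 1%N, candidate (nvar s 3) (nvar s 4) (nvar s 5), 0 < rvar s 4 &
       best_violation z (nvar s 3) (nvar s 4) (nvar s 5) = rvar s 4]).

Lemma guardE t m n s :
  (t <= T)%N -> (m <= T)%N -> (n < L)%N -> env z s -> at_index t m n s ->
  beval s guard = candidate t m n.
Proof.
move=> tT mT nL [eT eL _ _ _ eb _ _ _ en _] [a1 a2 a3].
rewrite /= a1 a2 a3 eT eL eb en // /candidate -/T -/L.
by move: (m%:R <= mbound p) => b; lia.
Qed.

Lemma record_sub (D D' : nat -> nat -> nat -> Prop) s :
  (forall t m n, D' t m n -> D t m n) -> record D s -> record D' s.
Proof. by move=> DD [rD r0]; split=> // t m n /DD; exact: rD. Qed.

Lemma reach_attempt D t m n s :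
  (t <= T)%N -> (m <= T)%N -> (n < L)%N -> env z s -> at_index t m n s ->
  record D s ->
  reach attempt s (500 * (T + 1))
    (record (fun t' m' n' => D t' m' n' \/ [/\ t' = t, m' = m & n' = n])).
Proof.
move=> tT mT nL es ats [rD r0].
apply: reach_leq; [apply: reach_if|shelve]; rewrite (guardE tT mT nL es ats); last first.
  move=> nc; apply: reach_skip; split=> // t' m' n' [/rD|[-> -> ->]] // c.
  by rewrite c in nc.
move=> ct; have /and5P[_ _ Lt mt _] := ct.
apply: reach_seq; apply: (@reach_evaluate _ p z LT t m n) => //.
- lia.
- by move: ct; rewrite /candidate; lia.
move=> s1 f1 v1 _ _; have [[n1 _ r1 _] [_ [a1 a2 a3]]] := (f1, ready_frame f1 (conj es ats) isT).
apply: reach_if => /=; rewrite (r1 4%N) // v1.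
  move=> le; apply: reach_skip; split.
    by rewrite (r1 4%N) // => t' m' n' [/rD|[-> -> ->]] // c.
  by rewrite (r1 4%N) // !n1.
rewrite -ltNge => gt.
apply/reach_seq/reach_rassign/reach_seq/reach_nassign/reach_seq/reach_nassign.
apply/reach_seq/reach_nassign/reach_nassign; rewrite /record /= /upd /= a1 a2 a3 v1.
split.
  by move=> t' m' n' [h c|[-> -> ->]] //; apply: le_trans (ltW gt); apply: rD.
right; split=> //; apply: le_lt_trans gt.
by case: r0 => [[_ ->]|[_ _ /ltW]].
Unshelve.
rewrite /=; lia.
Qed.

(** Triples are tried in lexicographic order, and each inner invariant adds its own progress to the
    region covered by the outer loops. *)
Lemma reach_search s : env z s -> nvar s 2 = 0%N -> rvar s 4 = 0 ->
  reach search s (600 * ((T + 1) * (T + 1) * (T + 1)) * (L + 1))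
    (fun s' => env z s' /\ record (fun t m n => [/\ (t <= T)%N, (m <= T)%N & (n < L)%N]) s').
Proof.
move=> es s2 s4; apply: reach_frame.
have eF W s1 s2' : frame W s1 s2' -> env z s1 -> ~~ has (mem ground) W -> env z s2'.
  by move=> f e g; apply: env_frame g f e.
apply: reach_leq; [|shelve].
(* The constants 500, 520, 560 and 600 grow with each level to pay for the loop control. *)
apply: (@reach_for _ _ _ _ _ _ (560 * ((T + 1) * (T + 1)) * (L + 1)) 0 T.+1
  (fun j => record (fun t m n => [/\ (t < j)%N, (m <= T)%N & (n < L)%N]))) => //.
- by move=> s1 /eF/(_ es isT) [/= -> *]; rewrite addn1.
- by split; [move=> ? ? ? []|left].
- move=> t s1 tT /eF/(_ es isT) es1 s1t r1; have {}tT : (t <= T)%N by lia.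
  apply: reach_leq; [|shelve].
  apply: (@reach_for _ _ _ _ _ _ (520 * (T + 1) * (L + 1)) 0 T.+1 (fun j => record (fun t' m n => 
      [/\ (t' < t)%N, (m <= T)%N & (n < L)%N] \/ [/\ t' = t, (m < j)%N & (n < L)%N]))) => //.
  + by move=> s1' /eF/(_ es1 isT) [/= -> *]; rewrite addn1.
  + by apply: record_sub r1 => t' m n [//|[]].
  + move=> m s2' mT f2; have es2 := eF _ _ _ f2 es1 isT.
    have {f2} s2t : nvar s2' 6 = t by case: f2 => ->.
    move=> s2m r2; have {}mT : (m <= T)%N by lia.
    apply: reach_leq; [|shelve].
    apply: (@reach_for _ _ _ _ _ _ (500 * (T + 1)) 0 L (fun j => record (fun t' m' n =>
      ([/\ (t' < t)%N, (m' <= T)%N & (n < L)%N] \/ [/\ t' = t, (m' < m)%N & (n < L)%N]) \/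
      [/\ t' = t, m' = m & (n < j)%N]))) => //.
    * by move=> s3 /eF/(_ es2 isT) [_ /= -> *].
    * by apply: record_sub r2 => t' m' n [//|[]].
    * move=> n s3 nL f3 s3n r3; have es3 := eF _ _ _ f3 es2 isT.
      have at3 : at_index t m n s3 by case: f3 => f3 _ _ _; split; rewrite // f3.
      have {}nL : (n < L)%N by lia.
      apply: reach_weaken (reach_attempt tT mT nL es3 at3 r3) (leqnn _) _.
      move=> s5 _; apply: record_sub => t' m' n'.
      move=> [h|[-> -> h]]; first by left; left.
      case: (eqVneq n' n) => [->|nn]; [by right|left; right; split=> //; lia].
    * move=> s3 _; apply: record_sub => t' m' n' [h|[-> h h']]; first by left; left.
      rewrite max0n; case: (eqVneq m' m) => [->|mm]; [by right|left; right; split=> //; lia].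
  + move=> s3 _; apply: record_sub => t' m' n' [h h1 h2].
    rewrite max0n; case: (eqVneq t' t) => [->|tt]; [by right|left; split=> //; lia].
- move=> s3 _ + fs; rewrite max0n => r3; split; first exact: eF fs es isT.
  exact: record_sub r3.
Unshelve.
all: rewrite /=; nia.
Qed.

Lemma reach_recover s : (0 < L)%N -> 0 < ramp p -> env z s ->
  record (fun t m n => [/\ (t <= T)%N, (m <= T)%N & (n < L)%N]) s ->
  reach recover s (1000 * (T + 1)) (separates z).
Proof.
move=> L0 V0 es [rD r0].
(* The search bounds [best_violation] for every candidate triple, which in turn bounds the violation
   for every S. *)
have vle q : admissible q -> violation z q <= rvar s 4.
  case: q => t m n A /(admissibleP _ _ _ _ L0) [c hA].
  have [tT nL mt] : [/\ (t <= T)%N, (n < L)%N & (m <= t)%N].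
    by split; move: c; rewrite /candidate; lia.
  apply: le_trans (rD t m n _ c); last by split=> //; lia.
  exact: violation_le.
apply: reach_frame; apply: reach_leq; [apply: reach_if|shelve]; last first.
  rewrite /= -ltnNge ltnS leqn0 => /eqP s2; apply: reach_skip => _; right; split=> // q /vle.
  by case: r0 => [[_ ->]|[]] //; rewrite s2.
rewrite /= => flag; case: r0 => [[s2 _]|[s2 c s4 vE]]; first by rewrite s2 in flag.
move: c vE; move s3: (nvar s 3) => t; move s4': (nvar s 4) => m.
move s5: (nvar s 5) => n c vE.
have [tT nL mt nT] : [/\ (t <= T)%N, (n < L)%N, (m <= t)%N & (n <= T - t)%N].
  by split; move: c; rewrite /candidate; lia.
apply: reach_seq.
apply: (@reach_for _ _ _ _ _ _ _ 0 T.+1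
  (fun j s' => forall i, (i < j)%N -> narr s' 0 i = 0%N)) => //.
- move=> s1 f1; have [/= -> *] := env_frame (isT : ~~ has (mem ground) (writes clear_marks)) f1 es.
  by rewrite addn1.
- move=> j s1 _ _ vj I1; apply: reach_nset; rewrite /= vj => i ij.
  rewrite /upd2 /upd /=; case: (eqVneq i j) => // ne; apply: I1; lia.
move=> s1 f1; rewrite max0n => z1.
have es1 : env z s1 by apply: env_frame f1 es.
have [n1 _ _ _] := f1.
do 3! apply/reach_seq/reach_nassign.
set s6 := set_nvar _ 8 _.
apply: (@reach_evaluate _ p z LT t m n) => //.
- lia.
- by case: es1; split.
- by split; rewrite /s6 /= /upd /= n1 // ?s3 ?s4' ?s5.
move=> s' _ _ g o [fs _ _ _]; left; rewrite /output_index !fs // s2 s3 s4' s5.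
split=> //; set A := [set _ | _].
(* Labels 0, ..., T were cleared, so a nonzero mark can only come from the window of this scan. *)
have inA (i : 'I_T.+1) : i \in A -> (t - m < i <= t)%N.
  by rewrite inE; apply: contraNT => hi; rewrite o // /s6 /= z1.
have vA : violation z (Index t m n A) = best_violation z t m n.
  apply: violation_greedy => // k km; rewrite inE inordK; last by rewrite ltnS; lia.
  by rewrite g //; case: (_ < _).
split; first by apply/admissibleP.
  by rewrite vA vE.
by move=> q /vle; rewrite vA vE.
Unshelve.
rewrite /=; lia.
Qed.

End Separation.

(** * Composition of the three phases and the cubic bound *)

Theorem proposition6 (R : realType) :
  exists alg : cmd,
  forall (mu : R) (nu : nat),
  exists c : nat,
  forall (p : params R) (z : point R (horizon p)),
    valid_params p ->
    mbound p = mu ->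
    (uptime p - 1)%N = nu ->
    nonneg_point z ->
    exists (s : state R) (k : nat),
      [/\ exec alg (input z) s k,
          (k <= c * horizon p ^ 3)%N &
          separates z s].
Proof.
(* Here 2600 adds the constants 1000, 600 and 1000 of the three phases, [nu + 2] is L + 1, and 8
   comes from cubing T + 1 <= 2T. *)
exists separation => mu nu; exists (8 * 2600 * (nu + 2))%N => p z [L0 LT _ V0] _ nuE _.
have {}LT : (uptime p <= horizon p)%N by lia.
apply: reach_leq.
  apply: reach_step (reach_setup z LT) _ => s1 [n1 _ r1 _] es1.
  apply: reach_step (reach_search LT es1 _ _) _; rewrite ?n1 ?r1 // => s2 _ [es2 rec2].
  exact: reach_recover.
rewrite -nuE.
have T0 : (0 < horizon p)%N by lia.
have h1 : (horizon p + 1 <= (horizon p + 1) * (horizon p + 1) * (horizon p + 1))%N.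
  by nia.
have h2 : ((horizon p + 1) * (horizon p + 1) * (horizon p + 1) <= 8 * horizon p ^ 3)%N.
  rewrite !expnS expn0 muln1.
  have h : (horizon p + 1 <= 2 * horizon p)%N by lia.
  by have := leq_mul (leq_mul h h) h; nia.
nia.
Qed.
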